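(* Let $G$ be any group. If $a\in G$ and $b\in G$ is such that both $b\in R_4(G)$ and $b^{-1}\in R_4(G)$, then the subgroup $\langle a, a^b\rangle$ is nilpotent of class at most $4$.
   Context: For elements $a,b$ of a group, $a^b := b^{-1}ab$, $[a,b]:=a^{-1}b^{-1}ab$, and the Engel commutators are defined inductively by $[a,_0 b]:=a$ and $[a,_n b]:=[[a,_{n-1} b],b]$ for $n>0$. An element $x\in G$ is right $n$-Engel if $[x,_n g]=1$ for all $g\in G$; $R_n(G)$ denotes the set of all right $n$-Engel elements of $G$. *)

(* Defs.v *)
From mathcomp Require Import all_boot monoid.
From mathcomp Require Import boolp classical_sets.

Set Implicit Arguments.
Unset Strict Implicit.
Unset Printing Implicit Defensive.

Local Open Scope classical_set_scope.
Local Open Scope group_scope.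

(* Subgroups of a possibly infinite group are represented as classical sets;
   {group gT} and nil_class of MathComp are restricted to finite groups. *)

Fixpoint engel (G : groupType) (a : G) (n : nat) (b : G) : G :=
  if n is m.+1 then [~ engel a m b, b] else a.

Definition right_engel (G : groupType) (n : nat) : set G :=
  [set x | forall g, engel x n g = 1].

Definition subgroup (G : groupType) (H : set G) : Prop := group_closed [in H].

Definition generated (G : groupType) (A : set G) : set G :=
  smallest (@subgroup G) A.

(* lower_central H n is gamma_(n+1)(H): the series starts at index 0 here. *)
Fixpoint lower_central (G : groupType) (H : set G) (n : nat) : set G :=
  if n is m.+1 then
    generated [set z | exists x y, [/\ lower_central H m x, H y & z = [~ x, y]]]
  else H.

Definition nilpotent_of_class_at_most (G : groupType) (c : nat) (H : set G) :
    Prop :=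
  subgroup H /\ lower_central H c = [set 1].

(* Main.v *)
Require Import Defs.
From mathcomp Require Import all_boot monoid.
From mathcomp Require Import boolp classical_sets.

Local Open Scope classical_set_scope.
Local Open Scope group_scope.

(** Put [x = a], [y = a ^ b], [c = [~ x, y]], [e = [~ c, x]] and
    [f = [~ c, y]].

    The word [[~ b, g]] is [(g^-1) ^ b * g], so the fourth Engel condition on
    [b] at [g] only involves the two elements [g] and [g ^ b].  Unfolding it
    twice, each time replacing [[~ u, g, g] = 1] by the statement that [g]
    commutes with [g ^ u], turns the conditions at [g = x] and [g = x^-1] into:
    the subgroup generated by [x] and [x ^ y] has class at most 2.  In other
    words, [e] commutes with [x] and [c] ([right_engel4_commg]).  The same
    argument with [b^-1] and [y], whose conjugate by [b^-1] is [x], shows that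
    [f] commutes with [y] and [c].

    These four commutations alone force class at most 4
    ([commg_two_generated]).  The conjugates of [c] and [x] by powers of [y]
    are explicit: [c ^ y = c * f], [x ^ y = x * c], and so on.  Conjugating
    the two facts about [e] by [y] and [y^-1] therefore gives relations between
    [f] and its conjugates under [x] and [e].  These relations determine the
    action of [x] on the conjugates involved, and one more conjugation by [y]
    collapses them: [f] commutes with [e].  Then [c], [e], [f] and [f ^ x]
    pairwise commute, and [t = [~ f, x] = [~ e, y]] is central.

    Hence [t], then [e] and [f], then [c], then [x] and [y] lie in the first
    four terms of the upper central series, which bounds the lower central
    series ([nilpotent_upper_central]). *)

(** * Subgroups and the upper central series *)

Lemma subgroupP {G : groupType} (H : set G) :
  subgroup H <-> H 1 /\ forall u v, H u -> H v -> H (u / v).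
Proof.
split=> -[H1 HB]; split; try by move: H1; rewrite ?inE.
  by move=> u v Hu Hv; apply/set_mem/HB; apply/mem_set.
by move=> u v /set_mem Hu /set_mem Hv; apply/mem_set/HB.
Qed.

Lemma subgroup1 {G : groupType} {H : set G} : subgroup H -> H 1.
Proof. by case/subgroupP. Qed.

Lemma subgroupF {G : groupType} {H : set G} u v :
  subgroup H -> H u -> H v -> H (u / v).
Proof. by case/subgroupP => _ /[apply]/[apply]. Qed.

Lemma subgroupV {G : groupType} {H : set G} u : subgroup H -> H u -> H u^-1.
Proof. by move=> sH Hu; rewrite -[u^-1]mul1g; exact/subgroupF/Hu/subgroup1. Qed.

Lemma subgroupM {G : groupType} {H : set G} u v :
  subgroup H -> H u -> H v -> H (u * v).
Proof. by move=> sH Hu /(subgroupV _ sH)/(subgroupF _ _ sH Hu); rewrite invgK. Qed.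

Lemma subgroupJ {G : groupType} {H : set G} u v :
  subgroup H -> H u -> H v -> H (u ^ v).
Proof.
move=> sH Hu Hv; apply: subgroupM => //; first exact: subgroupV.
exact: subgroupM.
Qed.

Lemma subgroupR {G : groupType} {H : set G} u v :
  subgroup H -> H u -> H v -> H [~ u, v].
Proof.
move=> sH Hu Hv; apply: subgroupM => //; first exact: subgroupV.
exact: subgroupJ.
Qed.

Lemma subgroup_generated {G : groupType} (A : set G) : subgroup (generated A).
Proof.
apply/subgroupP; split=> [H [sH _]|u v Hu Hv H [sH AH]]; first exact: subgroup1.
by apply: subgroupF => //; [apply: Hu|apply: Hv].
Qed.

Lemma sub_generated {G : groupType} (A : set G) : A `<=` generated A.
Proof. exact: sub_gen_smallest. Qed.

Lemma generated_sub {G : groupType} (A H : set G) :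
  subgroup H -> A `<=` H -> generated A `<=` H.
Proof. by move=> sH AH z; apply; split. Qed.

(** The [n]-th centre of [H], relative to [H] and not to the ambient group. *)
Fixpoint upper_central {G : groupType} (H : set G) (n : nat) : set G :=
  if n is m.+1 then
    [set z | H z /\ forall h, H h -> upper_central H m [~ z, h]]
  else [set 1].

(** Both claims are proved in one induction: closure of the next term under
    division expands a commutator into a conjugate of two commutators, which
    needs normality of the current term. *)
Lemma upper_central_normal {G : groupType} (H : set G) n : subgroup H ->
  subgroup (upper_central H n) /\
  forall z h, upper_central H n z -> H h -> upper_central H n (z ^ h).
Proof.
move=> sH; elim: n => [|n [sZ nZ]] /=.
  split; first by apply/subgroupP; split=> // u v -> ->; rewrite /= mulgV.
  by move=> z h ->; rewrite /= conj1g.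
split.
  apply/subgroupP; split=> [|u v [Hu Zu] [Hv Zv]].
    split=> [|h _]; first exact: subgroup1.
    by rewrite comm1g; exact: subgroup1.
  split=> [|h Hh]; first exact: subgroupF.
  have -> : [~ u / v, h] = ([~ u, h] / [~ v, h]) ^ v^-1.
    by rewrite /commg /conjg !gnorm.
  by apply: nZ; [apply: subgroupF => //; [exact: Zu|exact: Zv]|exact: subgroupV].
move=> z k [Hz Zz] Hk; split=> [|h Hh]; first exact: subgroupJ.
rewrite -(conjgKV k h) -conjRg; apply: nZ => //; apply: Zz.
by apply: subgroupJ => //; exact: subgroupV.
Qed.

(** Since the [n]-th term is normal, the elements that commute with [z] modulo
    it form a subgroup, so generators suffice. *)
Lemma upper_centralS {G : groupType} (A : set G) n z :
  generated A z -> (forall s, A s -> upper_central (generated A) n [~ z, s]) ->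
  upper_central (generated A) n.+1 z.
Proof.
move=> Hz Zz; split=> // h Hh.
have sH := subgroup_generated A.
have [sZ nZ] := upper_central_normal _ n sH.
suff sub : generated A `<=`
    [set k | generated A k /\ upper_central (generated A) n [~ z, k]].
  by case: (sub h Hh).
apply: generated_sub => [|s As] /=; last first.
  by split; [exact: sub_generated|exact: Zz].
apply/subgroupP; split=> [|u v [Hu Zu] [Hv Zv]].
  by split; [exact: (subgroup1 sH)|rewrite commg1; exact: subgroup1].
split; first exact: (subgroupF _ _ sH).
have -> : [~ z, u / v] = ([~ z, v]^-1 * [~ z, u]) ^ v^-1.
  by rewrite /commg /conjg !gnorm.
apply: nZ; last exact: (subgroupV _ sH).
by apply: subgroupM => //; exact: subgroupV.
Qed.

(** Each commutation with the whole group lowers the position in the upper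
    central series by one, so the [i]-th step of the lower central series is
    below the [c - i]-th centre. *)
Lemma nilpotent_upper_central {G : groupType} (A : set G) c :
  A `<=` upper_central (generated A) c ->
  nilpotent_of_class_at_most c (generated A).
Proof.
set H := generated A => AZ.
have sH : subgroup H := subgroup_generated A.
have sZ n : subgroup (upper_central H n) by case: (upper_central_normal _ n sH).
split=> //.
have sub i : i <= c -> lower_central H i `<=` upper_central H (c - i).
  elim: i => [_|i IHi ic]; first by rewrite subn0; exact: generated_sub.
  apply: generated_sub => // _ [u [h [Lu Hh ->]]].
  have := IHi (ltnW ic) _ Lu; rewrite -(subnSK ic) /= => -[_]; exact.
apply/seteqP; split=> [z Lz | _ ->].
  by have := sub c (leqnn c) _ Lz; rewrite subnn.
have: subgroup (lower_central H c) by case: (c) => [//|n]; exact: subgroup_generated.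
exact: subgroup1.
Qed.

(** * The right 4-Engel condition *)

Lemma conjg_fixE {G : groupType} (u v : G) : commute u v <-> u ^ v = u.
Proof.
split; first by move=> uv; rewrite /conjg uv mulKg.
by move=> uv; rewrite /commute conjgC uv.
Qed.

Lemma commuteJ {G : groupType} (z u v : G) :
  commute (u ^ z) (v ^ z) <-> commute u v.
Proof.
rewrite !conjg_fixE -conjJg; split; last by move->.
by move/conjg_inj.
Qed.

(** [[~ u, g]] is the product of [(g ^ u)^-1] and [g], so it commutes with [g]
    exactly when [g ^ u] does. *)
Lemma commute_conj_commg {G : groupType} (g u : G) :
  commute g (g ^ u) <-> commute [~ u, g] g.
Proof.
rewrite commgEr; split => [guC | gC].
  apply: commute_sym; apply: commuteM; last exact: commute_refl.
  by rewrite conjVg; apply: commuteV.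
have -> : g ^ u = (g^-1 ^ u * g * g^-1)^-1 by rewrite conjVg !gnorm.
apply: commuteV; apply: commuteM; first exact: commute_sym.
exact: commuteV (commute_refl g).
Qed.

(** The previous lemma is used once for the two outer commutators.  The factor
    [g] at the right of [[~ b, g, g]] and of [[~ b, g]] can then be removed by
    conjugation, as [g] is fixed by it. *)
Lemma engel4_commute {G : groupType} (b g : G) :
  engel b 4 g = 1 -> commute g (g ^ (g ^ (g ^ b)^-1)).
Proof.
move=> /eqP /commgP /= /commute_conj_commg.
set u := [~ b, g]; rewrite commgEr conjgM => H.
have {}H : commute g (g ^ (g^-1 ^ u)).
  by apply/(commuteJ g); rewrite {1}/conjg mulKg.
set h := g ^ (g ^ b)^-1.
have uE : g^-1 ^ u = h^-1 ^ g by rewrite /u commgEr conjgM !conjVg.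
move: H; rewrite uE => H.
have {}H : commute g (g ^ h^-1).
  apply/(commuteJ g); rewrite conjJg; move: H.
  by rewrite (_ : g ^ g = g) // /conjg mulKg.
by apply: commute_sym; apply/(commuteJ h^-1); rewrite conjgK.
Qed.

(** With [h = g ^ b], the conditions at [g] and [g^-1] say that [g ^ h] commutes
    with [(g ^ h) ^ g] and [g] with [g ^ (g ^ h)].  So [g] and [g ^ h = g * c]
    generate a group of class at most 2. *)
Lemma right_engel4_commg {G : groupType} (b g : G) :
  right_engel 4 b -> let c := [~ g, g ^ b] in
  commute [~ c, g] g /\ commute [~ c, g] c.
Proof.
move=> bR c; set h := g ^ b.
have cE : g ^ h = g * c by rewrite /c /commg mulVKg.
have gPE : [~ g, g ^ h] = [~ c, g]^-1 by rewrite invgR cE /commg /conjg !gnorm.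
have fromV x : commute [~ c, g]^-1 x -> commute [~ c, g] x.
  by rewrite -{2}[[~ c, g]]invgK => /commute_sym/commuteV/commute_sym.
have eC1 : commute [~ c, g] (g * c).
  have /(commuteJ h) := engel4_commute _ _ (bR g).
  by rewrite conjJg conjgKV => /commute_conj_commg; rewrite gPE cE => /fromV.
have eC2 : commute [~ c, g] g.
  have: commute g (g ^ (g ^ h)^-1).
    have := engel4_commute _ _ (bR g^-1).
    rewrite !conjVg invgK => /commuteV/commute_sym/commuteV/commute_sym.
    by rewrite !invgK.
  move=> /(commuteJ (g ^ h)); rewrite conjgKV => /commute_sym.
  by move=> /commute_conj_commg; rewrite -invgR gPE invgK.
split=> //; rewrite -[X in commute _ X](mulKg g).
by apply: commuteM => //; apply: commuteV.
Qed.

(** * Two generators with commuting third commutators *)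

Lemma commgM_fix {G : groupType} (u v z : G) :
  u ^ z = u -> [~ u, v * z] = [~ u, v] ^ z.
Proof. by move=> uz; rewrite !commgEl conjMg conjVg uz conjgM. Qed.

(** In the notation of the proof, [r] and [g] are the conjugates of [f] by
    [e^-1] and [x], while [p] and [k] are those of [g] by [e^-1] and [e^-2].
    Commutation of [e] with [c], conjugated by [y] and [y^-1], gives
    [k * r = f * p] and [r * k = p * f]; commutation of [e] with [x] gives in
    the same way the values of [p ^ x] and [g ^ x].  The latter make the
    conjugates by [x] of [g * r * r] and [r * r * p] equal, and conjugating
    [g * r * r = r * r * p] by [y] yields [f = r], that is, [f] commutes with
    [e].  Then [g = p = k], and the central element is [f^-1 * p]. *)
Lemma commg_two_generated {G : groupType} (x y c e f : G) :
  [~ x, y] = c -> [~ c, x] = e -> [~ c, y] = f ->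
  commute e x -> commute e c -> commute f y -> commute f c ->
  exists t, [/\ [~ e, y] = t, [~ f, x] = t, commute t x & commute t y].
Proof.
move=> cE eE fE ex ec fy fc.
have c_x : c ^ x = c * e by rewrite -eE commgEl mulVKg.
have c_y : c ^ y = c * f by rewrite -fE commgEl mulVKg.
have x_y : x ^ y = x * c by rewrite -cE commgEl mulVKg.
have /conjg_fixE f_y := fy; have /conjg_fixE f_c := fc.
have /conjg_fixE e_x := ex; have /conjg_fixE e_c := ec.
have eV_c : e^-1 ^ c = e^-1 by rewrite conjVg e_c.
have eV_x : e^-1 ^ x = e^-1 by rewrite conjVg e_x.
have [r rE] : exists r, r = f ^ e^-1 by exists (f ^ e^-1).
have [g gE] : exists g, g = f ^ x by exists (f ^ x).
have [p pE] : exists p, p = g ^ e^-1 by exists (g ^ e^-1).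
have [k kE] : exists k, k = p ^ e^-1 by exists (p ^ e^-1).
have ef : e * f = r * e by rewrite rE -conjgCV.
have eg : e * g = p * e by rewrite pE -conjgCV.
have ep : e * p = k * e by rewrite kE -conjgCV.
(* Conjugation by x sends c to c * e, and f commutes with c, so g commutes with
   c * e: on g, conjugation by c is conjugation by e^-1. *)
have g_c : g ^ c = p.
  by apply: (conjg_inj e); rewrite pE conjgKV -conjgM -c_x gE -conjJg f_c.
have p_c : p ^ c = k by rewrite pE conjJg g_c eV_c.
have r_x : r ^ x = p by rewrite rE conjJg eV_x -gE.
have [w wE] : exists w, w = f^-1 * p * e by exists (f^-1 * p * e).
have [v vE] : exists v, v = f * p^-1 * e by exists (f * p^-1 * e).
have cfx : [~ c * f, x] = w.
  by rewrite commgEl conjMg c_x -gE wE -(mulgA _ p) -eg !gnorm.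
have cfVx : [~ c * f^-1, x] = v.
  have egV : p^-1 * e = e * g^-1 by apply: (mulgI p); rewrite !gnorm -eg !gnorm.
  by rewrite commgEl conjMg c_x conjVg -gE vE -(mulgA f) egV !gnorm.
have w_c : w ^ c = f^-1 * k * e.
  by rewrite wE !conjMg conjVg f_c p_c e_c.
have v_c : v ^ c = f * k^-1 * e.
  by rewrite vE !conjMg conjVg f_c p_c e_c.
have v_cV : v ^ c^-1 = f * g^-1 * e.
  have fcV : f ^ c^-1 = f by rewrite -{1}f_c conjgK.
  have ecV : e ^ c^-1 = e by rewrite -{1}e_c conjgK.
  by rewrite vE !conjMg conjVg fcV ecV -g_c conjgK.
have cf_c : (c * f) ^ c = c * f by rewrite conjMg f_c /conjg mulKg.
have cfV_z : (c * f^-1) ^ (c^-1 * f) = c * f^-1.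
  have -> : c^-1 * f = (c * f^-1)^-1.
    by rewrite invgM invgK; apply/commute_sym/commuteV.
  by rewrite /conjg invgK mulgV mulg1.
(* Conjugation by y sends c to c * f and x to x * c, and c can be taken out
   of the commutator since it commutes with c * f; the same with y^-1, c * f^-1 and c^-1 * f. *)
have e_y : e ^ y = w ^ c by rewrite -eE conjRg c_y x_y commgM_fix ?cfx.
have c_yV : c ^ y^-1 = c * f^-1.
  by apply: (conjg_inj y); rewrite conjgKV conjMg conjVg f_y c_y mulgK.
have x_yV : x ^ y^-1 = x * (c^-1 * f).
  apply: (conjg_inj y); rewrite conjgKV !conjMg conjVg f_y c_y x_y.
  by rewrite -(fc : f * c = c * f) !gnorm.
have e_yV : e ^ y^-1 = v ^ (c^-1 * f).
  by rewrite -eE conjRg c_yV x_yV commgM_fix ?cfVx.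
(* Conjugates by y and y^-1 of the commutations of e with c and with x. *)
have w_cf : w ^ (c * f) = w.
  apply/conjg_fixE/(commuteJ c); rewrite cf_c -e_y -c_y; exact/commuteJ.
have v_cf : v ^ (c * f^-1) = v.
  apply/conjg_fixE/(commuteJ (c^-1 * f)); rewrite cfV_z -e_yV -c_yV.
  exact/commuteJ.
have w_cx : w ^ (c * x) = w.
  apply/conjg_fixE/(commuteJ c).
  rewrite (_ : (c * x) ^ c = x ^ y); last by rewrite x_y /conjg !gnorm.
  rewrite -e_y; exact/commuteJ.
have v_cfx : v ^ (c^-1 * f * x) = v.
  apply/conjg_fixE/(commuteJ (c^-1 * f)).
  rewrite (_ : (_ * x) ^ _ = x ^ y^-1); last by rewrite x_yV /conjg mulgA mulKg.
  rewrite -e_yV; exact/commuteJ.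
have efV : e * f^-1 = r^-1 * e by rewrite rE -conjVg -conjgCV.
have kr : k * r = f * p.
  move: w_cf; rewrite conjgM w_c wE /conjg -!mulgA ef => /mulgI H.
  by apply: (mulIg e); apply: (mulgI f^-1); rewrite -!mulgA mulKg.
have rk : r * k = p * f.
  move: v_cf; rewrite conjgM v_c vE /conjg invgK -!mulgA efV => /mulgI.
  rewrite !mulgA => /mulIg H; apply: invg_inj.
  by rewrite !invgM -H !gnorm.
have p_x : p ^ x = f^-1 * p * p.
  have k_x : k ^ x = g * f^-1 * p.
    move: w_cx; rewrite conjgM w_c wE !conjMg conjVg -gE e_x => /mulIg H.
    by rewrite -mulgA -H mulVKg.
  have: (k * r) ^ x = g * p ^ x by rewrite kr conjMg -gE.
  rewrite conjMg r_x k_x => H; apply: (mulgI g).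
  by rewrite -H !mulgA.
have g_x : g ^ x = p * p * f^-1.
  move: v_cfx; rewrite !conjgM v_cV vE.
  have -> : (f * g^-1 * e) ^ f = g^-1 * r * e.
    by rewrite /conjg -!mulgA mulKg ef.
  rewrite !conjMg conjVg r_x e_x => /mulIg H.
  by apply: (mulgI (g ^ x)^-1); rewrite mulVg !mulgA H !gnorm.
(* Conjugation by x makes both sides equal to p * p * f^-1 * p * p. *)
have grr : g * r * r = r * r * p.
  by apply: (conjg_inj x); rewrite !conjMg r_x p_x g_x !gnorm.
have g_y : g ^ y = p by rewrite gE conjJg f_y x_y conjgM -gE g_c.
have fVk : f^-1 * k = p * r^-1 by apply: (mulIg r); rewrite mulgVK -mulgA kr mulKg.
have eVy u : (u ^ e^-1) ^ y = p * r^-1 * ((u ^ y) ^ e^-1) * (p * r^-1)^-1.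
  by rewrite conjJg conjVg e_y w_c fVk /conjg !gnorm.
have r_y : r ^ y = p * r * p^-1 by rewrite [in LHS]rE eVy f_y -rE !gnorm.
have p_y : p ^ y = p * r^-1 * f.
  by rewrite [in LHS]pE eVy g_y -kE -fVk !gnorm.
(* After conjugation by y, grr reads p * r * r = r * f * p, while kr and rk
   give r * f * p = p * f * r. *)
have fr : f = r.
  move: grr => /(congr1 (conjg^~ y)); rewrite /= !conjMg g_y r_y p_y !gnorm.
  move=> H; apply: (mulgI p); apply: (mulIg r).
  have <- : r * f * p = p * f * r.
    by rewrite -(mulgA r) -kr -rk !mulgA.
  by apply: (mulgI p); apply: (mulIg p^-1); rewrite !gnorm H.
have gp : g = p by rewrite gE fr r_x.
have kp : k = p by rewrite kE -{1}gp -pE.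
have fp : p * f = f * p by rewrite -kr kp fr.
have p_y' : p ^ y = p by rewrite p_y fr mulgVK.
exists (f^-1 * p); split.
- apply: (mulgI e); rewrite commgEl mulVKg e_y w_c mulgA efV -fr.
  by rewrite -!mulgA ep.
- by rewrite commgEl -gE gp.
- apply/conjg_fixE; rewrite conjMg conjVg -gE gp p_x.
  by rewrite !mulgA -invgM -fp !gnorm.
- by apply/conjg_fixE; rewrite conjMg conjVg f_y p_y'.
Qed.

(** * Conjugates under right 4-Engel elements *)

Theorem theorem1p4 (G : groupType) (a b : G) :
  right_engel 4 b -> right_engel 4 b^-1 ->
  nilpotent_of_class_at_most 4 (generated [set a; a ^ b]).
Proof.
move=> bR bVR; set y := a ^ b; set A := [set a; y].
have [/= ea ec] := right_engel4_commg b a bR.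
have [/= dy dc] := right_engel4_commg b^-1 y bVR.
rewrite -/y in ea ec; rewrite /y conjgK -/y -(invgR a y) in dy dc.
set c := [~ a, y] in ea ec dy dc.
have fE : [~ c, y] = [~ c^-1, y]^-1.
  (* The left side is the conjugate by c of the right side. *)
  have /commuteV/commute_sym/commuteV := commute_sym dc; rewrite invgK.
  by move/conjg_fixE => <-; rewrite /commg /conjg !gnorm.
have fy : commute [~ c, y] y by rewrite fE; exact/commute_sym/commuteV/commute_sym.
have fc : commute [~ c, y] c.
  rewrite fE; apply/commute_sym/commuteV/commute_sym.
  by rewrite -[X in commute _ X]invgK; exact: commuteV.
have [t [ey fx tx ty]] :=
  commg_two_generated _ _ _ _ _ erefl erefl erefl ea ec fy fc.
set H := generated A; have sH : subgroup H := subgroup_generated A.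
have Ha : H a by apply: sub_generated; left.
have Hy : H y by apply: sub_generated; right.
have Hc : H c by exact: (subgroupR _ _ sH).
have He : H [~ c, a] by exact: (subgroupR _ _ sH).
have Hf : H [~ c, y] by exact: (subgroupR _ _ sH).
have Ht : H t by rewrite -fx; exact: (subgroupR _ _ sH).
have Z1 n : upper_central H n 1.
  by have [sZ _] := upper_central_normal H n sH; exact: subgroup1.
have ZV n z : upper_central H n z -> upper_central H n z^-1.
  by have [sZ _] := upper_central_normal H n sH; exact: subgroupV.
have Zt : upper_central H 1 t.
  by apply: upper_centralS => // s [->|->]; apply/eqP/commgP.
have Ze : upper_central H 2 [~ c, a].
  apply: upper_centralS => // s [->|->]; last by rewrite ey.
  by have /commgP/eqP-> := ea.
have Zf : upper_central H 2 [~ c, y].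
  apply: upper_centralS => // s [->|->]; first by rewrite fx.
  by have /commgP/eqP-> := fy.
have Zc : upper_central H 3 c by apply: upper_centralS => // s [->|->].
apply: nilpotent_upper_central => z [->|->]; apply: upper_centralS => // s [->|->].
- by rewrite commgg.
- exact: Zc.
- by rewrite -invgR; exact: ZV.
- by rewrite commgg.
Qed.
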